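(* Let $G=(V,E)$ be any infinite, connected, amenable, (vertex-)transitive, $d$-regular graph ($d<\infty$), and let $\Gamma=\mathsf{Aut}(G)$. Then there exist a Hilbert space $\mathcal H$ and a nonconstant map $\Psi:V\to\mathcal H$ such that $\Psi$ is harmonic, i.e. $$\Psi(x)=\frac1d\sum_{y:\{x,y\}\in E}\Psi(y)\qquad\text{for all }x\in V,$$ and $\Psi$ is $\Gamma$-equivariant, i.e. there is an action $\pi$ of $\Gamma$ on $\mathcal H$ by affine isometries such that $\pi(g)\Psi(x)=\Psi(gx)$ for all $g\in\Gamma$, $x\in V$.
   Context: A graph $G$ is amenable if there is a sequence of finite nonempty vertex subsets $\{S_j\}$ such that $|S_j\triangle N(S_j)|/|S_j|\to 0$, where $N(S_j)$ denotes the neighborhood of $S_j$ in $G$ (that is, $S_j$ together with all vertices adjacent to $S_j$). A graph is transitive if its automorphism group acts transitively on its vertices. *)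

(* Defs.v *)
From HB Require Import structures.
From mathcomp Require Import all_boot all_order all_algebra finmap.
From mathcomp Require Import all_classical all_reals all_analysis.

Set Implicit Arguments.
Unset Strict Implicit.
Unset Printing Implicit Defensive.

Import Order.TTheory GRing.Theory Num.Theory.
Import numFieldNormedType.Exports.

Local Open Scope classical_set_scope.
Local Open Scope ring_scope.

Section Graph.
Context {V : choiceType} (E : rel V).

Definition simple_graph := symmetric E /\ irreflexive E.

Definition connected_graph :=
  forall x y : V, exists2 p : seq V, path E x p & last x p = y.

Definition regular_graph (d : nat) := forall x : V, ([set y | E x y] #= `I_d)%card.

Definition closed_neighborhood (S : set V) : set V :=
  S `|` [set y | exists2 x, S x & E x y].

(* [fset_set] is junk on infinite sets: the numerator is meaningful because
   [amenable] is only used for regular, hence locally finite, graphs. *)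
Definition amenable (R : realType) :=
  exists S : nat -> set V,
    (forall j, finite_set (S j) /\ S j !=set0) /\
    (fun j => #|` fset_set (S j `+` closed_neighborhood (S j))|%:R
              / #|` fset_set (S j)|%:R : R) @ \oo --> (0 : R).

Record graph_aut := GraphAut {
  graph_aut_fun :> V -> V;
  graph_aut_bij : bijective graph_aut_fun;
  graph_aut_adj : forall x y, E (graph_aut_fun x) (graph_aut_fun y) = E x y
}.

Definition vertex_transitive := forall x y : V, exists g : graph_aut, g x = y.

Lemma graph_autP (g h : graph_aut) : g =1 h -> g = h.
Proof.
case: g h => [f bf Ef] [f' bf' Ef'] /= /funext fE; case: _ / fE in bf' Ef' *.
by congr GraphAut; exact: Prop_irrelevance.
Qed.

HB.instance Definition _ := gen_eqMixin graph_aut.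
HB.instance Definition _ := gen_choiceMixin graph_aut.

Definition graph_aut_one : graph_aut :=
  @GraphAut idfun (Bijective (fun _ => erefl) (fun _ => erefl))
    (fun _ _ => erefl).

Lemma graph_aut_mul_adj (g h : graph_aut) x y :
  E ((g \o h) x) ((g \o h) y) = E x y.
Proof. by rewrite /= !graph_aut_adj. Qed.

Definition graph_aut_mul (g h : graph_aut) : graph_aut :=
  GraphAut (bij_comp (graph_aut_bij g) (graph_aut_bij h))
    (graph_aut_mul_adj g h).

Lemma graph_aut_inv_ex (g : graph_aut) :
  exists h : graph_aut, cancel g h /\ cancel h g.
Proof.
have [h gK hK] := graph_aut_bij g.
have hE x y : E (h x) (h y) = E x y by rewrite -(graph_aut_adj g) !hK.
by exists (GraphAut (Bijective hK gK) hE).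
Qed.

Definition graph_aut_inv (g : graph_aut) : graph_aut :=
  sval (cid (graph_aut_inv_ex g)).

Lemma graph_aut_mulA : associative graph_aut_mul.
Proof. by move=> g h k; apply: graph_autP. Qed.

Lemma graph_aut_mul1 : left_id graph_aut_one graph_aut_mul.
Proof. by move=> g; apply: graph_autP. Qed.

Lemma graph_aut_mulr1 : right_id graph_aut_one graph_aut_mul.
Proof. by move=> g; apply: graph_autP. Qed.

Lemma graph_aut_mulV : left_inverse graph_aut_one graph_aut_inv graph_aut_mul.
Proof.
move=> g; apply: graph_autP => x /=.
by rewrite /graph_aut_inv; case: cid => h /= [gK _]; rewrite gK.
Qed.

Lemma graph_aut_mulrV : right_inverse graph_aut_one graph_aut_inv graph_aut_mul.
Proof.
move=> g; apply: graph_autP => x /=.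
by rewrite /graph_aut_inv; case: cid => h /= [_ hK]; rewrite hK.
Qed.

HB.instance Definition _ := isGroup.Build graph_aut
  graph_aut_mulA graph_aut_mul1 graph_aut_mulr1 graph_aut_mulV graph_aut_mulrV.

End Graph.

Record hilbertSpace (R : realType) := HilbertSpace {
  hilbert_sort :> completeNormedModType R;
  hilbert_dot : {dot hilbert_sort for idfun};
  hilbert_normE : forall u : hilbert_sort, hilbert_dot u u = `|u| ^+ 2
}.

Definition affine_isometry (R : realType) (H : hilbertSpace R) (T : H -> H) :=
  (exists (L : {linear H -> H}) (b : H), forall u, T u = L u + b) /\
  (forall u v, `|T u - T v| = `|u - v|).

Definition affine_isometric_action (R : realType) (G : groupType)
    (H : hilbertSpace R) (pi : G -> H -> H) :=
  [/\ forall u, pi 1%g u = u,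
      forall g h u, pi (g * h)%g u = pi g (pi h u)
    & forall g, affine_isometry (pi g)].

Definition harmonic_map (R : realType) (V : choiceType) (E : rel V) (d : nat)
    (H : hilbertSpace R) (Psi : V -> H) :=
  forall x, Psi x = (d%:R : R)^-1 *: \sum_(y \in [set y | E x y]) Psi y.

(* Main.v *)
(* Let Q be the lazy simple random walk operator on finitely supported functions
   and [ret j = <delta_o, Q^j delta_o>] its return probabilities; since Q
   commutes with automorphisms and G is transitive, they do not depend on o, and
   neither do the drops [dret j = ret j - ret j.+1].  The kernels
   [<delta_x - delta_o, Q^j (delta_y - delta_o)> / dret j] are invariant and
   positive semidefinite, and describe maps V -> Hilbert space whose energy is
   constant in j, while the squared norm of the defect of harmonicity is
   proportional to [1 - dret j.+1 / dret j].

   The sequence dret is log-convex, so [dret j.+1 / dret j] increases; a limit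
   rho < 1 would force ret, hence [<u, Q^j u>] for every u, to decay like
   rho^j, and log-convexity of the latter gives [<u, Q u> <= rho <u, u>],
   which fails for indicators of Folner sets.  So the defects tend to 0, and an
   ultralimit of the kernels yields a harmonic equivariant map.

   The Hilbert space attached to a positive semidefinite form on M is taken to be
   the space of form-bounded linear functionals on M, which is complete without
   any quotient or completion. *)
Require Import Defs.
From HB Require Import structures.
From mathcomp Require Import all_boot all_order all_algebra finmap.
From mathcomp Require Import all_classical all_reals all_analysis.
From mathcomp Require Import ring lra.

Set Implicit Arguments.
Unset Strict Implicit.
Unset Printing Implicit Defensive.

Import Order.TTheory GRing.Theory Num.Theory.
Import numFieldNormedType.Exports.

Local Open Scope classical_set_scope.
Local Open Scope ring_scope.

(** * Positive semidefinite forms and the Jordan-von Neumann theorem *)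

Record psd_form (R : realType) (M : lmodType R) := PsdForm {
  psd_fun :> M -> M -> R;
  psd_linear : forall w a u v,
    psd_fun (a *: u + v) w = a * psd_fun u w + psd_fun v w;
  psd_sym : forall u v, psd_fun u v = psd_fun v u;
  psd_ge0 : forall u, 0 <= psd_fun u u
}.

Section PsdForm.
Context {R : realType} {M : lmodType R}.
Variable B : psd_form M.

Lemma psdDl u v w : B (u + v) w = B u w + B v w.
Proof. by have := psd_linear B w 1 u v; rewrite scale1r mul1r. Qed.

Lemma psd0l w : B 0 w = 0.
Proof. by have := psdDl 0 0 w; rewrite addr0; lra. Qed.

Lemma psdZl a u w : B (a *: u) w = a * B u w.
Proof. by rewrite -[a *: u]addr0 psd_linear psd0l addr0. Qed.

Lemma psdDr u v w : B w (u + v) = B w u + B w v.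
Proof. by rewrite !(psd_sym B w) psdDl. Qed.

Lemma psdZr a u w : B w (a *: u) = a * B w u.
Proof. by rewrite !(psd_sym B w) psdZl. Qed.

Lemma psdBl u v w : B (u - v) w = B u w - B v w.
Proof. by rewrite psdDl -scaleN1r psdZl mulN1r. Qed.

Lemma psdBr u v w : B w (u - v) = B w u - B w v.
Proof. by rewrite !(psd_sym B w) psdBl. Qed.

Lemma psd_sqrD u v : B (u + v) (u + v) = B u u + 2 * B u v + B v v.
Proof. by rewrite psdDl !psdDr (psd_sym B v u); ring. Qed.

Lemma psd_sqrB u v : B (u - v) (u - v) = B u u - 2 * B u v + B v v.
Proof. by rewrite psdBl !psdBr (psd_sym B v u); ring. Qed.

Lemma psd_sqrZ a u : B (a *: u) (a *: u) = a ^+ 2 * B u u.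
Proof. by rewrite psdZl psdZr; ring. Qed.

Lemma psd_sqrD_le u v : B (u + v) (u + v) <= 2 * (B u u + B v v).
Proof. by have := psd_ge0 B (u - v); rewrite psd_sqrB psd_sqrD; lra. Qed.

Lemma psd_cauchy_schwarz u v : B u v ^+ 2 <= B u u * B v v.
Proof.
have [/eqP v0|v0] := boolP (B v v == 0).
  rewrite v0 mulr0; have [->|uv0] := eqVneq (B u v) 0; first by rewrite expr0n.
  (* Since [B v v = 0], this [t] makes the square of [u - t *: v] equal to [-1]. *)
  pose t := (B u u + 1) / (2 * B u v).
  have := psd_ge0 B (u - t *: v).
  rewrite psd_sqrB psd_sqrZ psdZr v0 mulr0.
  have -> : 2 * (t * B u v) = B u u + 1 by rewrite /t; field.
  by lra.
have {}v0 : 0 < B v v by rewrite lt0r v0 psd_ge0.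
have := psd_ge0 B (u - (B u v / B v v) *: v).
rewrite psd_sqrB psd_sqrZ psdZr.
have -> : B u u - 2 * (B u v / B v v * B u v) + (B u v / B v v) ^+ 2 * B v v =
  (B u u * B v v - B u v ^+ 2) / B v v by field; rewrite gt_eqF.
by rewrite pmulr_lge0 ?invr_gt0// subr_ge0.
Qed.

End PsdForm.

(** The deviation [psi] of [phi] from the line through [phi 1] vanishes on the integers, so it is
    1-periodic and therefore bounded. As [psi (n t) = n psi t], it must be zero. *)
Lemma additive_bounded_linear (R : realType) (phi : {additive R -> R}) (C : R) :
  (forall t, 0 <= t <= 1 -> `|phi t| <= C) -> forall t, phi t = t * phi 1.
Proof.
move=> phiC.
pose psi t := phi t - t * phi 1.
have psiMn t n : psi (n%:R * t) = n%:R * psi t.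
  by rewrite /psi mulr_natl raddfMn -[phi t *+ n]mulr_natl -[t *+ n]mulr_natl; ring.
pose C' := C + `|phi 1|.
have psiC t : `|psi t| <= C'.
  have -> : psi t = psi (t - (Num.floor t)%:~R).
    rewrite /psi raddfB /= -[(Num.floor t)%:~R]/(1 *~ _) raddfMz.
    by rewrite -[phi 1 *~ _]mulrzl; ring.
  have ft : 0 <= t - (Num.floor t)%:~R <= 1.
    by rewrite subr_ge0 floor_le_tmp /= lerBlDl ltW// -intrD1 lt_succ_floor.
  rewrite (le_trans (ler_normB _ _))// lerD ?phiC// normrM ler_piMl//.
  by case/andP: ft => f0 f1; rewrite ger0_norm.
move=> t; apply/eqP; rewrite -subr_eq0 -[_ - _]/(psi t) -normr_eq0.
apply/eqP/le_anti; rewrite normr_ge0 andbT leNgt; apply/negP => psit.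
have := psiC ((Num.bound (C' / `|psi t|))%:R * t).
rewrite psiMn normrM normr_nat leNgt => /negP; apply.
rewrite -ltr_pdivrMr//; apply: le_lt_trans (archi_boundP _); first exact: lexx.
by rewrite divr_ge0// (le_trans _ (psiC t)).
Qed.

Section JordanVonNeumann.
Context {R : realType} {M : lmodType R}.
Variable q : M -> R.
Hypothesis q_ge0 : forall u, 0 <= q u.
Hypothesis qZ : forall a u, q (a *: u) = a ^+ 2 * q u.
Hypothesis q_parallelogram : forall u v, q (u + v) + q (u - v) = 2 * (q u + q v).

Definition polar u v := (q (u + v) - q (u - v)) / 4.

Let qN u : q (- u) = q u.
Proof. by rewrite -scaleN1r qZ sqrrN expr1n mul1r. Qed.

Lemma polar_sym u v : polar u v = polar v u.
Proof. by rewrite /polar (addrC u v) -(qN (u - v)) opprB. Qed.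

(** Half of the first two parallelogram laws minus the third. The terms other than [q (u + w)] and
    [q (v + w)] do not change when [w] becomes [- w], so they cancel in [polar]. *)
Let q_add3 u v w :
  q (u + v + w) = q (u + w) + q (v + w) + q u + q v - q w - q (u - v).
Proof.
have h1 := q_parallelogram (u + w) v.
have h2 := q_parallelogram (v + w) u.
have h3 := q_parallelogram w (u - v).
have e1 : u + w + v = u + v + w by rewrite addrAC.
have e2 : v + w + u = u + v + w by rewrite addrC addrA.
have e3 : w + (u - v) = u + w - v by rewrite addrCA addrA.
have e4 : w - (u - v) = v + w - u by rewrite opprB addrCA addrA.
by rewrite e1 in h1; rewrite e2 in h2; rewrite e3 e4 in h3; lra.
Qed.

Lemma polarDl u v w : polar (u + v) w = polar u w + polar v w.
Proof. by rewrite /polar !q_add3 (qN w); field. Qed.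

Lemma polarZl a u w : polar (a *: u) w = a * polar u w.
Proof.
pose phi t := polar (t *: u) w.
have phiD : zmod_morphism phi.
  move=> s t; apply/eqP; rewrite eq_sym subr_eq; apply/eqP.
  by rewrite /phi -polarDl -scalerDl subrK.
pose phiL := GRing.isZmodMorphism.Build _ _ phi phiD.
pose phiA : {additive R -> R} := HB.pack phi phiL.
(* The two values of [q] in [polar] are nonnegative with sum [2 (t^2 q u + q w)], so a quarter of
   their difference obeys this bound on the unit interval. *)
have := @additive_bounded_linear R phiA ((q u + q w) / 2).
rewrite /= /phi scale1r; apply => t /andP[t0 t1].
have := q_parallelogram (t *: u) w; rewrite qZ /polar => h.
have t2 : t ^+ 2 * q u <= q u by rewrite ler_piMl// expr_le1.
have := q_ge0 (t *: u + w); have := q_ge0 (t *: u - w).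
by rewrite ler_norml => ? ?; apply/andP; split; lra.
Qed.

Lemma polarE u : polar u u = q u.
Proof.
rewrite /polar subrr -{1 2}[u]scale1r -scalerDl qZ.
by rewrite -(scale0r (0 : M)) qZ; field.
Qed.

Definition polar_form : psd_form M.
Proof.
exists polar => [w a u v|u v|u]; first by rewrite polarDl polarZl.
  exact: polar_sym.
by rewrite polarE.
Defined.

End JordanVonNeumann.

(** * The Hilbert space of a positive semidefinite form *)

Section Gns.
Context {R : realType} {M : lmodType R}.
Variable B : psd_form M.

(** The functionals continuous for the seminorm of [B]. They vanish where [B m m = 0], which takes
    the place of a quotient by the null space. *)
Definition bounded_functional : {pred M -> R} := fun F =>
  `[< (forall a u v, F (a *: u + v) = a * F u + F v) /\
      exists C, forall m, F m ^+ 2 <= C * B m m >].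

Record gns := Gns { gns_fun :> M -> R; gns_funP : gns_fun \in bounded_functional }.

HB.instance Definition _ := [isSub for gns_fun].
HB.instance Definition _ := [Choice of gns by <:].

Lemma bounded_functional_submod_closed : submod_closed bounded_functional.
Proof.
split=> [|a F G /asboolP[Fl [C FC]] /asboolP[Gl [D GD]]]; apply/asboolP; split.
- by move=> a u v /=; rewrite mulr0 addr0.
- by exists 0 => m; rewrite mul0r expr0n.
- move=> b u v; rewrite /= !fctE Fl Gl /GRing.scale /=; ring.
- exists (2 * (a ^+ 2 * C + D)) => m.
  have -> : (a *: F + G) m = a * F m + G m by [].
  apply: (@le_trans _ _ (2 * (a ^+ 2 * F m ^+ 2 + G m ^+ 2))).
    by rewrite -exprMn; have := sqr_ge0 (a * F m - G m); rewrite sqrrB sqrrD; lra.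
  have := ler_wpM2l (sqr_ge0 a) (FC m); have := GD m.
  by lra.
Qed.

HB.instance Definition _ := GRing.isSubmodClosed.Build _ _ bounded_functional
  bounded_functional_submod_closed.
HB.instance Definition _ := [SubChoice_isSubLmodule of gns by <:].

Implicit Types F G : gns.

Lemma gnsP F G : (forall m, F m = G m) -> F = G.
Proof. by move=> FG; exact/val_inj/funext. Qed.

Lemma gnsD F G m : (F + G) m = F m + G m. Proof. by []. Qed.
Lemma gnsB F G m : (F - G) m = F m - G m. Proof. by []. Qed.
Lemma gnsZ a F m : (a *: F) m = a * F m. Proof. by []. Qed.

Lemma gns_linear F a u v : F (a *: u + v) = a * F u + F v.
Proof. by case: F => F /= /asboolP[]. Qed.

Lemma gns_bounded F : exists C, forall m, F m ^+ 2 <= C * B m m.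
Proof. by case: F => F /= /asboolP[]. Qed.

Lemma gns0r F : F 0 = 0.
Proof. by have := gns_linear F 1 0 0; rewrite scale1r addr0; lra. Qed.

Lemma gnsDr F u v : F (u + v) = F u + F v.
Proof. by have := gns_linear F 1 u v; rewrite scale1r mul1r. Qed.

Lemma gnsZr F a u : F (a *: u) = a * F u.
Proof. by rewrite -[a *: u]addr0 gns_linear gns0r addr0. Qed.

Lemma gnsBr F u v : F (u - v) = F u - F v.
Proof. by rewrite gnsDr -scaleN1r gnsZr mulN1r. Qed.

(* The squared dual norm, as the convex conjugate of [m |-> B m m]; in this
   form the parallelogram law is a substitution. *)
Definition gns_sqr F := sup [set 2 * F m - B m m | m in [set: M]].

(** By the arithmetic-geometric inequality, [2 F m] is at most [B m m] plus the absolute value of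
    [C]. The constant [C] itself may be negative if [B] vanishes. *)
Let gns_has_sup F : has_sup [set 2 * F m - B m m | m in [set: M]].
Proof.
split; first by exists (2 * F 0 - B 0 0), 0.
have [C FC] := gns_bounded F; exists `|C| => _ [m _ <-].
rewrite leNgt; apply/negP => lt; have B0 := psd_ge0 B m.
have C0 := normr_ge0 C.
have := FC m; have : C * B m m <= `|C| * B m m by rewrite ler_wpM2r// ler_norm.
by have := sqr_ge0 (`|C| - B m m); nra.
Qed.

Lemma gns_sqr_ub F m : 2 * F m - B m m <= gns_sqr F.
Proof. by apply: ub_le_sup; [case: (gns_has_sup F)|exists m]. Qed.

Lemma gns_sqr_le F c : (forall m, 2 * F m - B m m <= c) -> gns_sqr F <= c.
Proof.
move=> Fc; apply: ge_sup; first by case: (gns_has_sup F).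
by move=> _ [m _ <-].
Qed.

Lemma gns_sqr_ge0 F : 0 <= gns_sqr F.
Proof. by have := gns_sqr_ub F 0; rewrite gns0r psd0l subr0 mulr0. Qed.

Lemma gns_sqr_bound F m : F m ^+ 2 <= gns_sqr F * B m m.
Proof.
have [C FC] := gns_bounded F; have B0 := psd_ge0 B m.
have [B00|Bm] := eqVneq (B m m) 0.
  by rewrite B00 mulr0 (le_trans (FC m))// B00 mulr0.
have {Bm}B0' : 0 < B m m by rewrite lt0r Bm.
(* Among the multiples of [m] this one maximises the expression in the supremum. *)
have := gns_sqr_ub F ((F m / B m m) *: m); rewrite gnsZr psd_sqrZ.
have -> : 2 * (F m / B m m * F m) - (F m / B m m) ^+ 2 * B m m =
  F m ^+ 2 / B m m by field; rewrite gt_eqF.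
by rewrite ler_pdivrMr.
Qed.

Let gns_sqrZ_le a F : gns_sqr (a *: F) <= a ^+ 2 * gns_sqr F.
Proof.
apply: gns_sqr_le => m; rewrite gnsZ; have [->|a0] := eqVneq a 0.
  by have := psd_ge0 B m; rewrite expr0n !mul0r; lra.
have := gns_sqr_ub F (a^-1 *: m); rewrite gnsZr psd_sqrZ => h.
have a2 : 0 < a ^+ 2 by rewrite exprn_even_gt0.
apply: le_trans (ler_wpM2l (ltW a2) h).
by rewrite le_eqVlt; apply/orP; left; apply/eqP; field.
Qed.

Lemma gns_sqrZ a F : gns_sqr (a *: F) = a ^+ 2 * gns_sqr F.
Proof.
apply/le_anti; rewrite gns_sqrZ_le /=.
have [->|a0] := eqVneq a 0; first by rewrite expr0n mul0r gns_sqr_ge0.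
have := gns_sqrZ_le a^-1 (a *: F); rewrite scalerA mulVf// scale1r exprVn => h.
by rewrite -ler_pdivlMl// exprn_even_gt0.
Qed.

Let gns_parallelogram_le F G :
  gns_sqr (F + G) + gns_sqr (F - G) <= 2 * (gns_sqr F + gns_sqr G).
Proof.
rewrite -lerBrDr; apply: gns_sqr_le => u.
rewrite lerBrDr addrC -lerBrDr; apply: gns_sqr_le => v.
rewrite gnsB gnsD.
(* Testing [F] at the half sum and [G] at the half difference matches the linear terms; the
   parallelogram law of [B] matches the quadratic ones. *)
have := gns_sqr_ub F (2^-1 *: (u + v)); have := gns_sqr_ub G (2^-1 *: (u - v)).
rewrite !gnsZr gnsBr gnsDr !psd_sqrZ psd_sqrB psd_sqrD.
by lra.
Qed.

(** The converse inequality is the one already proved, applied to [F + G] and [F - G], whose sum and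
    difference are [2 *: F] and [2 *: G]. *)
Lemma gns_parallelogram F G :
  gns_sqr (F + G) + gns_sqr (F - G) = 2 * (gns_sqr F + gns_sqr G).
Proof.
apply/le_anti; rewrite gns_parallelogram_le /=.
have := gns_parallelogram_le (F + G) (F - G).
have -> : F + G + (F - G) = 2 *: F by apply: gnsP => m; rewrite !(gnsB, gnsD, gnsZ); ring.
have -> : F + G - (F - G) = 2 *: G by apply: gnsP => m; rewrite !(gnsB, gnsD, gnsZ); ring.
by rewrite !gns_sqrZ; lra.
Qed.

Definition gns_form := polar_form gns_sqr_ge0 gns_sqrZ gns_parallelogram.

Lemma gns_formE F : gns_form F F = gns_sqr F.
Proof. exact: polarE gns_sqrZ _. Qed.

Definition gns_norm F := Num.sqrt (gns_sqr F).

Lemma gns_normD F G : gns_norm (F + G) <= gns_norm F + gns_norm G.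
Proof.
rewrite -(ler_pXn2r (_ : 0 < 2)%N) ?nnegrE ?addr_ge0 ?sqrtr_ge0//.
rewrite sqrrD !sqr_sqrtr ?gns_sqr_ge0// -!gns_formE psd_sqrD lerD2r lerD2l.
rewrite mulr_natl lerMn2r /= (le_trans (ler_norm _))//.
rewrite -(ler_pXn2r (_ : 0 < 2)%N) ?nnegrE ?mulr_ge0 ?sqrtr_ge0//.
rewrite exprMn !sqr_sqrtr ?gns_sqr_ge0// -!gns_formE real_normK ?num_real//.
exact: (psd_cauchy_schwarz gns_form).
Qed.

Lemma gns_normZ a F : gns_norm (a *: F) = `|a| * gns_norm F.
Proof. by rewrite /gns_norm gns_sqrZ sqrtrM ?sqr_ge0// sqrtr_sqr. Qed.

Lemma gns_norm_eq0 F : gns_norm F = 0 -> F = 0.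
Proof.
move/eqP; rewrite sqrtr_eq0 => F0; apply: gnsP => m.
have := gns_sqr_bound F m; have := psd_ge0 B m => B0 h.
apply/eqP; rewrite -sqrf_eq0 eq_le sqr_ge0 andbT.
by rewrite (le_trans h)// mulr_le0_ge0.
Qed.

HB.instance Definition _ :=
  Lmodule_isNormed.Build R gns gns_normD gns_normZ gns_norm_eq0.

Lemma gns_normE F : `|F| = Num.sqrt (gns_sqr F). Proof. by []. Qed.

Lemma gns_sqrE F : gns_sqr F = `|F| ^+ 2.
Proof. by rewrite gns_normE sqr_sqrtr// gns_sqr_ge0. Qed.

Lemma gns_le_norm F m : `|F m| <= `|F| * Num.sqrt (B m m).
Proof.
rewrite -(ler_pXn2r (_ : 0 < 2)%N) ?nnegrE ?mulr_ge0 ?sqrtr_ge0//.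
rewrite exprMn -gns_sqrE sqr_sqrtr ?psd_ge0// real_normK ?num_real//.
exact: gns_sqr_bound.
Qed.

(** With [gns_le_norm], this identifies the norm with the operator norm for the seminorm of [B]. It
    rests on [2 c s - s ^+ 2 <= c ^+ 2]. *)
Lemma gns_norm_le F c : 0 <= c ->
  (forall m, `|F m| <= c * Num.sqrt (B m m)) -> `|F| <= c.
Proof.
move=> c0 Fc; rewrite -(ler_pXn2r (_ : 0 < 2)%N) ?nnegrE// -gns_sqrE.
apply: gns_sqr_le => m; have B0 := psd_ge0 B m.
have := sqr_ge0 (c - Num.sqrt (B m m)); rewrite sqrrB sqr_sqrtr//.
have := Fc m; have := ler_norm (F m); rewrite -mulr_natl; lra.
Qed.

(** The limit [l] is taken pointwise. By [near_l] the convergence is uniform relative to the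
    seminorm of [B], so [l] is again a bounded functional and is the limit in norm. *)
Lemma gns_complete (Fi : set_system gns) : ProperFilter Fi -> cauchy Fi -> cvg Fi.
Proof.
move=> FF /cauchy_ballP cF.
have {}cF e : 0 < e -> \forall F \near Fi, \forall G \near Fi, `|F - G| < e.
  by move=> /cF /nearP_dep; apply: filterS => F; rewrite -ball_normE.
have cFm (m : M) : cvg ((fun F : gns => F m : R) @ Fi).
  apply/cauchy_cvgP/cauchy_exP => e e0.
  pose s := Num.sqrt (B m m) + 1.
  have s0 : 0 < s by rewrite ltr_wpDl ?sqrtr_ge0.
  have [F FG] := filter_ex (cF _ (divr_gt0 e0 s0)); exists (F m).
  apply: filterS FG => G; rewrite ltr_pdivlMr// -ball_normE /= => lte.
  rewrite -gnsB (le_lt_trans (gns_le_norm _ _))// (le_lt_trans _ lte)//.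
  by rewrite ler_wpM2l// lerDl.
pose l m : R := lim ((fun F : gns => F m) @ Fi).
have near_l e : 0 < e -> 
    \forall F \near Fi, forall m, `|gns_fun F m - l m| <= e * Num.sqrt (B m m).
  move=> e0; apply: filterS (cF _ e0) => F FG m; apply/ler_addgt0Pr => d d0.
  have := cFm m => /cvgrPdist_lt /(_ _ d0) /= ld.
  have [G [FGe Gd]] := filter_ex (filterI FG ld).
  rewrite (le_trans (ler_distD (G m) _ _))// lerD//.
    by rewrite -gnsB (le_trans (gns_le_norm _ _))// ler_wpM2r ?sqrtr_ge0// ltW.
  by rewrite distrC ltW.
have lP : l \in bounded_functional.
  apply/asboolP; split.
    move=> a u v; apply: cvg_lim => //.
    under eq_fun do rewrite gns_linear.
    by apply: cvgD; [apply: cvgMr|]; exact: cFm.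
  have [F Fl] := filter_ex (near_l _ ltr01).
  exists ((`|F| + 1) ^+ 2) => m.
  rewrite -[B m m]sqr_sqrtr ?psd_ge0// -exprMn -(real_normK (num_real (l m))).
  rewrite ler_pXn2r ?nnegrE ?mulr_ge0 ?addr_ge0 ?sqrtr_ge0//.
  have := Fl m; rewrite mul1r mulrDl mul1r => h.
  have -> : l m = F m - (F m - l m) by ring.
  by rewrite (le_trans (ler_normB _ _))// lerD// gns_le_norm.
apply/cvg_ex; exists (Gns lP); apply/cvgrPdist_le => e e0.
apply: filterS (near_l e e0) => F Fl; apply: gns_norm_le; first exact: ltW.
by move=> m; rewrite gnsB distrC.
Qed.

HB.instance Definition _ := Uniform_isComplete.Build gns gns_complete.

Let gns_dot_bilinear : bilinear_for
  ( *%R : GRing.Scale.law _ _) (idfun \; *%R) gns_form.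
Proof.
split=> u a v w; first exact: (psd_linear gns_form).
by rewrite (psdDr gns_form) (psdZr gns_form).
Qed.

HB.instance Definition _ := bilinear_isBilinear.Build R gns gns R
  ( *%R ) (idfun \; *%R) gns_form gns_dot_bilinear.

Let gns_dot_hermitian u v : gns_form u v = (-1) ^+ false * idfun (gns_form v u).
Proof. by rewrite mul1r (psd_sym gns_form). Qed.

HB.instance Definition _ := isHermitianSesquilinear.Build R gns false idfun
  gns_form gns_dot_hermitian.

Let gns_dot_gt0 u : u != 0 -> 0 < gns_form u u.
Proof. by move=> u0; rewrite gns_formE gns_sqrE exprn_gt0// normr_gt0. Qed.

HB.instance Definition _ := isDotProduct.Build R gns gns_form gns_dot_gt0.

Definition gns_hilbert : hilbertSpace R :=
  @HilbertSpace R gns gns_form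
    (fun u => etrans (gns_formE u) (gns_sqrE u)).

Let gns_vec_subproof u : (B u : M -> R) \in bounded_functional.
Proof.
apply/asboolP; split=> [a v w|]; first by rewrite psdDr psdZr.
by exists (B u u) => m; exact: psd_cauchy_schwarz.
Qed.

Definition gns_vec u : gns := Gns (gns_vec_subproof u).

Lemma gns_vecE u m : gns_vec u m = B u m. Proof. by []. Qed.

Lemma gns_vec_linear a u v : gns_vec (a *: u + v) = a *: gns_vec u + gns_vec v.
Proof. by apply: gnsP => m; rewrite gnsD gnsZ /= psd_linear. Qed.

HB.instance Definition _ :=
  GRing.isLinear.Build R M gns _ gns_vec gns_vec_linear.

Lemma gns_vecD u v : gns_vec (u + v) = gns_vec u + gns_vec v.
Proof. exact: linearD. Qed.

(** Nonnegativity of [B] at [u - m] bounds every term of the supremum, which is attained at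
    [m = u]. *)
Lemma gns_vec_norm u : `|gns_vec u| ^+ 2 = B u u.
Proof.
rewrite -gns_sqrE; apply/le_anti/andP; split.
  apply: gns_sqr_le => m; rewrite /= -subr_ge0.
  by have := psd_ge0 B (u - m); rewrite psd_sqrB; lra.
by have := gns_sqr_ub (gns_vec u) u; rewrite /=; lra.
Qed.

End Gns.

(** * Affine actions, ultralimits and powers of a contraction *)

Section GnsAction.
Context {R : realType} {M : lmodType R} {Gr : groupType}.
Variables (B : psd_form M) (act : Gr -> M -> M) (c : Gr -> M).
Hypothesis act_linear : forall g a u v, act g (a *: u + v) = a *: act g u + act g v.
Hypothesis act1 : forall u, act 1%g u = u.
Hypothesis actM : forall g h u, act (g * h)%g u = act g (act h u).
Hypothesis act_isom : forall g u v, B (act g u) (act g v) = B u v.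
Hypothesis c_cocycle : forall g h, c (g * h)%g = act g (c h) + c g.

Let pull_subproof g (F : gns B) :
  (fun m => F (act g^-1%g m)) \in bounded_functional B.
Proof.
apply/asboolP; split=> [a u v|]; first by rewrite act_linear gns_linear.
by have [C FC] := gns_bounded F; exists C => m; rewrite -(act_isom g^-1%g).
Qed.

(** The contragredient representation; the inverse makes it a left action that extends [act] along
    [gns_vec]. *)
Definition gns_pull g F : gns B := Gns (pull_subproof g F).

Let gns_pull_is_linear g : linear (gns_pull g).
Proof. by move=> a F G; apply: gnsP. Qed.

HB.instance Definition _ g :=
  GRing.isLinear.Build R (gns B) (gns B) _ (gns_pull g) (gns_pull_is_linear g).

Lemma gns_pull1 F : gns_pull 1%g F = F.
Proof. by apply: gnsP => m /=; rewrite invg1 act1. Qed.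

Lemma gns_pullM g h F : gns_pull (g * h)%g F = gns_pull g (gns_pull h F).
Proof. by apply: gnsP => m /=; rewrite invgM actM. Qed.

Lemma gns_pull_vec g u : gns_pull g (gns_vec B u) = gns_vec B (act g u).
Proof.
by apply: gnsP => m /=; rewrite -(act_isom g) -actM mulgV act1.
Qed.

Let gns_pull_norm_le g F : `|gns_pull g F| <= `|F|.
Proof.
apply: gns_norm_le => // m /=.
by rewrite -(act_isom g^-1%g); exact: gns_le_norm.
Qed.

Lemma gns_pull_norm g F : `|gns_pull g F| = `|F|.
Proof.
apply/le_anti; rewrite gns_pull_norm_le /=.
by have := gns_pull_norm_le g^-1%g (gns_pull g F); rewrite -gns_pullM mulVg gns_pull1.
Qed.

Definition gns_affine g (F : gns B) : gns B := gns_pull g F + gns_vec B (c g).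

(** The cocycle identity is what lets the translation parts compose; at [(1, 1)] it forces
    [c 1 = 0]. *)
Lemma gns_affine_isometric_action :
  @affine_isometric_action R Gr (gns_hilbert B) gns_affine.
Proof.
split=> [F|g h F|g].
- have c1 : c 1%g = 0.
    have := c_cocycle 1%g 1%g; rewrite mulg1 act1 => /eqP.
    by rewrite eq_sym -subr_eq0 addrK => /eqP.
  rewrite /gns_affine gns_pull1 c1; apply: gnsP => m.
  by rewrite gnsD gns_vecE psd0l addr0.
- rewrite /gns_affine gns_pullM c_cocycle gns_vecD -gns_pull_vec.
  by rewrite addrA (linearD (gns_pull g)).
- split; first by exists (gns_pull g), (gns_vec B (c g)).
  move=> F G; rewrite /gns_affine.
  rewrite [X in `|X|](_ : _ = gns_pull g (F - G)) ?gns_pull_norm//.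
  by rewrite (linearB (gns_pull g)) opprD addrACA subrr addr0.
Qed.

Lemma gns_affine_vec g u : gns_affine g (gns_vec B u) = gns_vec B (act g u + c g).
Proof. by rewrite /gns_affine gns_pull_vec gns_vecD. Qed.

End GnsAction.

(** * Ultralimits of sequences of forms *)

Section Ultralimit.
Context {R : realType}.
Variable U : set_system nat.
Hypothesis U_ultra : UltraFilter U.
Hypothesis U_oo : \oo `<=` U.

(** Compactness of the segment gives a cluster point, and an ultrafilter converges to each of its
    cluster points. *)
Lemma ultra_bounded_cvg (u : nat -> R) (C : R) :
  (forall j, `|u j| <= C) -> cvg (u @ U).
Proof.
move=> uC.
have UA : (u @ U) `[- C, C]%classic.
  rewrite /fmap /=; apply: (@filterE _ U) => j /=.
  by have := uC j; rewrite ler_norml in_itv.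
have [p [_ clp]] := @segment_compact R (- C) C (u @ U) _ UA.
apply/cvg_ex; exists p => N Np.
have [//|UN] := in_ultra_setVsetC (u @^-1` N) U_ultra.
have [] := clp (~` N) N; [exact: UN|exact: Np|].
by move=> x [].
Qed.

Context {M : lmodType R}.
Variable B : nat -> psd_form M.

(** A bound on the diagonal is enough for ultralimits to exist, by [ulim_cvg]. For the normalized
    walk it is available on differences [delta x - delta y], through [pair_bound]. *)
Definition bounded_along : {pred M} :=
  fun u => `[< exists C, forall j, B j u u <= C >].

Record bdd := Bdd { bdd_val :> M; bdd_valP : bdd_val \in bounded_along }.

HB.instance Definition _ := [isSub for bdd_val].
HB.instance Definition _ := [Choice of bdd by <:].

Lemma bounded_along_submod_closed : submod_closed bounded_along.
Proof.
split=> [|a u v /asboolP[C uC] /asboolP[D vD]]; apply/asboolP.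
  by exists 0 => j; rewrite psd0l.
exists (2 * (a ^+ 2 * C + D)) => j.
rewrite (le_trans (psd_sqrD_le _ _ _))// ler_wpM2l// lerD// psd_sqrZ.
by rewrite ler_wpM2l// sqr_ge0.
Qed.

HB.instance Definition _ := GRing.isSubmodClosed.Build _ _ bounded_along
  bounded_along_submod_closed.
HB.instance Definition _ := [SubChoice_isSubLmodule of bdd by <:].

Definition ulim (u v : bdd) : R := lim ((fun j => B j u v) @ U).

Lemma ulim_cvg (u v : bdd) : cvg ((fun j => B j u v) @ U).
Proof.
case: u v => [u /asboolP[C uC]] [v /asboolP[D vD]] /=.
(* Nonnegativity at [u + v] and [u - v] bounds an off-diagonal value by half the sum of the two
   diagonal ones. *)
apply: (@ultra_bounded_cvg _ ((C + D) / 2)) => j.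
have := psd_ge0 (B j) (u + v); have := psd_ge0 (B j) (u - v).
have := uC j; have := vD j.
by rewrite psd_sqrB psd_sqrD ler_norml => ? ? ? ?; apply/andP; split; lra.
Qed.

Definition ulim_form : psd_form bdd.
Proof.
exists ulim => [w a u v|u v|u].
- apply: cvg_lim => //; under eq_fun do rewrite psd_linear.
  by apply: cvgD; [apply: cvgMr|]; exact: ulim_cvg.
- by rewrite /ulim; under eq_fun do rewrite psd_sym.
- apply: limr_ge; first exact: ulim_cvg.
  by apply: nearW => j; exact: psd_ge0.
Defined.

Lemma ulim_formE (u : bdd) (l : R) :
  (fun j => B j u u) @ \oo --> l -> ulim_form u u = l.
Proof. by move=> h; apply: cvg_lim => // A /h /U_oo. Qed.

End Ultralimit.

(** * Moments and defect of a positive self-adjoint operator *)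

Section Moments.
Context {R : realType} {M : lmodType R}.
Variables (B : psd_form M) (Q : {linear M -> M}).
Hypothesis Q_sym : forall u v, B (Q u) v = B u (Q v).
Hypothesis Q_ge0 : forall u, 0 <= B u (Q u).

Let iterQ_sym j u v : B (iter j Q u) v = B u (iter j Q v).
Proof. by elim: j u v => [|j IH] u v //; rewrite iterSr IH Q_sym. Qed.

Definition power_form (j : nat) : psd_form M.
Proof.
exists (fun u v => B u (iter j Q v)) => [w a u v|u v|u].
- exact: psd_linear.
- by rewrite -iterQ_sym psd_sym.
(* Half of the powers move to the left argument, leaving [B w w] or [B w (Q w)] with
   [w = iter j./2 Q u]. *)
- rewrite -(odd_double_half j) iterD -addnn iterD.
  case: (odd j) => /=; last by rewrite -iterQ_sym psd_ge0.
  by rewrite -iterS iterSr -iterQ_sym Q_ge0.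
Defined.

Lemma power_formE j u v : power_form j u v = B u (iter j Q v).
Proof. by []. Qed.

(** Cauchy-Schwarz for [power_form j] at [u] and [Q u]. Log-convexity of moments does here the work
    of a spectral measure. *)
Lemma power_form_logconvex j u :
  power_form j.+1 u u ^+ 2 <= power_form j u u * power_form j.+2 u u.
Proof.
have := psd_cauchy_schwarz (power_form j) u (Q u).
rewrite !power_formE -!iterSr.
by rewrite (_ : B (Q u) _ = B u (iter j.+2 Q u))// Q_sym.
Qed.

End Moments.

Section Defect.
Context {R : realType} {M : lmodType R}.
Variables (B : psd_form M) (Q : {linear M -> M}).
Hypothesis Q_sym : forall u v, B (Q u) v = B u (Q v).
Hypothesis Q_ge0 : forall u, 0 <= B u (Q u).
Hypothesis Q_le1 : forall u, B u (Q u) <= B u u.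

(** The form of [1 - Q]. Its moments are the drops [<u, Q^j u> - <u, Q^(j+1) u>], so that
    [power_form_logconvex] applies to them as well. *)
Definition defect_form : psd_form M.
Proof.
exists (fun u v => B u v - B u (Q v)) => [w a u v|u v|u].
- by rewrite !psd_linear; ring.
- by rewrite psd_sym -Q_sym (psd_sym B (Q u)).
- by rewrite subr_ge0.
Defined.

Lemma defect_formE u v : defect_form u v = B u v - B u (Q v).
Proof. by []. Qed.

Lemma defect_sym u v : defect_form (Q u) v = defect_form u (Q v).
Proof. by rewrite !defect_formE !Q_sym. Qed.

(* [Q(1-Q) = Q(1-Q)Q + (1-Q)Q(1-Q)] *)
Lemma defect_ge0 u : 0 <= defect_form u (Q u).
Proof.
have := Q_ge0 (u - Q u); have := Q_le1 (Q u).
by rewrite defect_formE linearB /= !(psdBl, psdBr) !Q_sym; lra.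
Qed.

End Defect.

Lemma ratio_cvg1 (R : realType) (D : nat -> R) :
  (forall j, 0 < D j) -> (forall j, D j.+1 <= D j) ->
  (forall j, D j.+1 ^+ 2 <= D j * D j.+2) ->
  (forall rho, 0 < rho < 1 -> exists j, rho * D j < D j.+1) ->
  (fun j => D j.+1 / D j) @ \oo --> (1 : R).
Proof.
move=> D0 Dle Dlc Dgap.
have mono i j : (i <= j)%N -> D i.+1 / D i <= D j.+1 / D j.
  elim: j => [|j IH]; first by rewrite leqn0 => /eqP->.
  rewrite leq_eqVlt ltnS => /predU1P[->//|/IH /le_trans]; apply.
  by rewrite ler_pdivrMr// mulrAC ler_pdivlMr// -expr2 mulrC Dlc.
apply/cvgrPdist_le => e e0.
have [i Di] : exists i, 1 - e <= D i.+1 / D i.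
  (* The gap hypothesis requires [0 < 1 - e]; for larger [e] any index works, the ratios being
     nonnegative. *)
  have [e1|e1] := leP 1 e.
    by exists 0%N; rewrite (@le_trans _ _ 0) ?subr_le0// divr_ge0 ?ltW.
  have [|i Di] := Dgap (1 - e); first by apply/andP; split; lra.
  by exists i; rewrite ler_pdivlMr// ltW.
near=> j.
have ij : (i <= j)%N by near: j; exact: nbhs_infty_ge.
have := mono _ _ ij; have : D j.+1 / D j <= 1 by rewrite ler_pdivrMr// mul1r.
by move=> ? ?; rewrite ler_norml; apply/andP; split; lra.
Unshelve. all: by end_near. Qed.

(** * Finitely supported functions *)

Section FinSupp.
Context {R : realType} {V : choiceType}.

Definition fin_supp : {pred V -> R} := fun f => `[< finite_set [set x | f x != 0] >].

Record fsf := Fsf { fsf_fun :> V -> R; fsf_funP : fsf_fun \in fin_supp }.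

HB.instance Definition _ := [isSub for fsf_fun].
HB.instance Definition _ := [Choice of fsf by <:].

Lemma fin_supp_submod_closed : submod_closed fin_supp.
Proof.
split=> [|a u v /asboolP us /asboolP vs]; apply/asboolP.
  by rewrite (_ : [set _ | _] = set0)//; apply/seteqP; split=> x //=; rewrite eqxx.
have : finite_set ([set x | u x != 0] `|` [set x | v x != 0]) by rewrite finite_setU.
apply: sub_finite_set => x /=.
have -> : (a *: u + v) x = a * u x + v x by [].
have [->|?] := eqVneq (u x) 0; last by left.
by rewrite mulr0 add0r; right.
Qed.

HB.instance Definition _ := GRing.isSubmodClosed.Build _ _ fin_supp
  fin_supp_submod_closed.
HB.instance Definition _ := [SubChoice_isSubLmodule of fsf by <:].

Implicit Types u v : fsf.

Lemma fsfP u v : (forall x, u x = v x) -> u = v.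
Proof. by move=> uv; exact/val_inj/funext. Qed.

Lemma fsfD u v x : (u + v) x = u x + v x. Proof. by []. Qed.
Lemma fsfB u v x : (u - v) x = u x - v x. Proof. by []. Qed.
Lemma fsfZ a u x : (a *: u) x = a * u x. Proof. by []. Qed.

Lemma fsf_sum I (s : seq I) (F : I -> fsf) x : (\sum_(i <- s) F i) x = \sum_(i <- s) F i x.
Proof. by elim/big_rec2: _ => // i y z _ <-. Qed.

Definition supp u : {fset V} := fset_set [set x | u x != 0].

Lemma mem_supp u x : (x \in supp u) = (u x != 0).
Proof.
rewrite in_fset_set; last by case: u => u /= /asboolP.
by apply/idP/idP => [/set_mem|h]; [|exact/mem_set].
Qed.

Let delta_subproof x : (fun y => (x == y)%:R) \in fin_supp.
Proof.
apply/asboolP; apply: (@sub_finite_set _ _ [set x]) => // y /=.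
by rewrite pnatr_eq0 eqb0 negbK => /eqP->.
Qed.

Definition delta x : fsf := Fsf (delta_subproof x).

Lemma deltaE x y : delta x y = (x == y)%:R. Proof. by []. Qed.

Lemma fsf_expand u : u = \sum_(x <- supp u) u x *: delta x.
Proof.
apply: fsfP => y; rewrite fsf_sum.
have [yu|yu] := boolP (y \in supp u); last first.
  rewrite big_seq big1; last first.
    move=> x xu; rewrite fsfZ deltaE; case: eqVneq => [xy|]; last by rewrite mulr0.
    by rewrite -xy xu in yu.
  by apply/eqP; move: yu; rewrite mem_supp negbK.
rewrite (big_fsetD1 y yu) fsfZ deltaE eqxx mulr1 big_seq big1 => [|x].
  by rewrite /= addr0.
by rewrite !inE fsfZ deltaE => /andP[/negPf-> _]; rewrite mulr0.
Qed.

Lemma fsf_ind (K : fsf -> Prop) :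
  K 0 -> (forall a u v, K u -> K v -> K (a *: u + v)) ->
  (forall x, K (delta x)) -> forall u, K u.
Proof.
move=> K0 KP Kd u; rewrite (fsf_expand u).
by elim/big_ind: _ => // [v w|x _]; [rewrite -{2}[v]scale1r|rewrite -[_ *: _]addr0]; exact: KP.
Qed.

Section Ext.
Context {W : lmodType R} (f : V -> W).

Definition ext u : W := \sum_(x <- supp u) u x *: f x.

(** Enlarging the range of summation lets functions with different supports be compared over one
    finite set. *)
Lemma extE (A : {fset V}) u : {subset supp u <= A} -> ext u = \sum_(x <- A) u x *: f x.
Proof.
move=> /fsubsetP uA; apply: big_fset_incl => // x xA.
by rewrite mem_supp negbK => /eqP->; rewrite scale0r.
Qed.

Lemma ext_is_linear : linear ext.
Proof.
move=> a u v; pose A := (supp u `|` supp v)%fset.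
rewrite !(@extE A).
- rewrite scaler_sumr -big_split; apply: eq_bigr => x _.
  by rewrite fsfD fsfZ scalerDl scalerA.
- by move=> x xv; rewrite inE xv orbT.
- by move=> x xu; rewrite inE xu.
- move=> x; rewrite inE !mem_supp fsfD fsfZ.
  by have [->|] := eqVneq (u x) 0; rewrite ?mulr0 ?add0r.
Qed.

HB.instance Definition _ := GRing.isLinear.Build R fsf W _ ext ext_is_linear.

Lemma ext_delta x : ext (delta x) = f x.
Proof.
rewrite (@extE [fset x]%fset) ?big_seq_fset1 ?deltaE ?eqxx ?scale1r// => y.
by rewrite mem_supp deltaE inE pnatr_eq0 eqb0 negbK eq_sym.
Qed.

End Ext.

Definition ip u v : R := ext (fun x => v x) u.

Let ip_sum u v (A : {fset V}) : {subset supp u <= A} ->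
  ip u v = \sum_(x <- A) u x * v x.
Proof. exact: extE. Qed.

Definition ip_form : psd_form fsf.
Proof.
exists ip => [w a u v|u v|u].
- by rewrite /ip linearP.
- rewrite !(@ip_sum _ _ (supp u `|` supp v)%fset).
  + by apply: eq_bigr => x _; rewrite mulrC.
  + by move=> x xv; rewrite inE xv orbT.
  + by move=> x xu; rewrite inE xu.
- by rewrite (@ip_sum _ _ (supp u))// sumr_ge0// => x _; rewrite -expr2 sqr_ge0.
Defined.

Lemma ip_formE u v (A : {fset V}) : {subset supp u <= A} ->
  ip_form u v = \sum_(x <- A) u x * v x.
Proof. exact: ip_sum. Qed.

Lemma ip_delta x v : ip_form (delta x) v = v x.
Proof. by rewrite /= /ip ext_delta. Qed.

Definition mass : fsf -> R := ext (fun _ => 1).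

HB.instance Definition _ := GRing.Linear.on mass.

Lemma mass_delta x : mass (delta x) = 1.
Proof. exact: ext_delta. Qed.

Lemma sum_le_mass u (A : {fset V}) : (forall x, 0 <= u x) ->
  \sum_(x <- A) u x <= mass u.
Proof.
move=> u0; rewrite /mass (@extE _ _ (A `|` supp u)%fset); last first.
  by move=> x xu; rewrite inE xu orbT.
pose F x := if x \in A then u x else 0.
have -> : \sum_(x <- A) u x = \sum_(x <- A) F x.
  by rewrite big_seq [RHS]big_seq; apply: eq_bigr => x; rewrite /F => ->.
rewrite (@big_fset_incl _ _ _ _ _ (A `|` supp u)%fset) ?fsubsetUl//; last first.
  by move=> x _; rewrite /F => /negPf->.
by apply: ler_sum => x _; rewrite /GRing.scale /= mulr1 /F; case: ifP.
Qed.

Let sqr_subproof u : (fun x => u x ^+ 2) \in fin_supp.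
Proof.
apply/asboolP; case: u => u /= /asboolP; apply: sub_finite_set => x /=.
by rewrite sqrf_eq0.
Qed.

Definition fsf_sqr u : fsf := Fsf (sqr_subproof u).

Lemma mass_sqr u : mass (fsf_sqr u) = ip_form u u.
Proof.
rewrite /mass (@extE _ _ (supp u)); last by move=> x; rewrite !mem_supp sqrf_eq0.
by rewrite (@ip_formE _ _ (supp u))//; apply: eq_bigr => x _; rewrite /GRing.scale /= mulr1.
Qed.

Section Translation.
Variable g : V -> V.

(** The pushforward along [g], defined on deltas so that no inverse of [g] is needed. *)
Definition trans : fsf -> fsf := ext (fun x => delta (g x)).

HB.instance Definition _ := GRing.Linear.on trans.

Lemma trans_delta x : trans (delta x) = delta (g x).
Proof. exact: ext_delta. Qed.

Hypothesis g_inj : injective g.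

Lemma transE u x : trans u (g x) = u x.
Proof.
elim/fsf_ind: u => [|a u v IHu IHv|y]; first by rewrite linear0.
  by rewrite linearP !fsfD !fsfZ IHu IHv.
by rewrite trans_delta !deltaE (inj_eq g_inj).
Qed.

Lemma ip_trans u v : ip_form (trans u) (trans v) = ip_form u v.
Proof.
elim/fsf_ind: u => [|a u w IHu IHw|y]; first by rewrite linear0 !psd0l.
  by rewrite linearP !psd_linear IHu IHw.
by rewrite trans_delta !ip_delta transE.
Qed.

End Translation.

End FinSupp.
Arguments fsf : clear implicits.

(** * The lazy random walk *)

Section Walk.
Context {R : realType} {V : choiceType}.
Variables (E : rel V) (d : nat).
Hypothesis Esimple : simple_graph E.
Hypothesis Ereg : regular_graph E d.
Hypothesis d_gt0 : (0 < d)%N.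

Local Notation fsf := (fsf R V).
Implicit Types u v : fsf.

Let dR_gt0 : 0 < d%:R :> R. Proof. by rewrite ltr0n. Qed.
Let dR_neq0 : d%:R != 0 :> R. Proof. exact: lt0r_neq0. Qed.

Definition nb (x : V) : {fset V} := fset_set [set y | E x y].

Let nb_finite x : finite_set [set y | E x y].
Proof. by exists d; exact: Ereg. Qed.

Lemma mem_nb x y : (y \in nb x) = E x y.
Proof.
rewrite in_fset_set//.
by apply/idP/idP => [/set_mem|h]; [|exact/mem_set].
Qed.

Lemma card_nb x : #|` nb x| = d.
Proof. exact/card_fset_set/Ereg. Qed.

Lemma sum_nb_const x (c : R) : \sum_(y <- nb x) c = d%:R * c.
Proof. by rewrite big_const_seq count_predT card_nb iter_addr_0 mulr_natl. Qed.

Definition nbmean : fsf -> fsf :=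
  ext (fun x => d%:R^-1 *: \sum_(y <- nb x) delta y).
HB.instance Definition _ := GRing.Linear.on nbmean.

Lemma nbmean_delta x : nbmean (delta x) = d%:R^-1 *: \sum_(y <- nb x) delta y.
Proof. exact: ext_delta. Qed.

Lemma nbmean_deltaE x y : nbmean (delta x) y = d%:R^-1 * (E x y)%:R.
Proof.
rewrite nbmean_delta fsfZ fsf_sum; congr (_ * _).
have [xy|xy] := boolP (E x y).
  rewrite (big_fsetD1 y) ?mem_nb//= eqxx big_seq big1 ?addr0// => z.
  by rewrite !inE => /andP[/negPf->].
rewrite big_seq big1// => z; rewrite mem_nb deltaE.
by case: eqVneq => // -> ; rewrite (negPf xy).
Qed.

Lemma nbmean_sym u v : ip_form (nbmean u) v = ip_form u (nbmean v).
Proof.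
elim/(@fsf_ind R V): u => [|a u w IHu IHw|x]; first by rewrite linear0 !psd0l.
  by rewrite linearP !psd_linear IHu IHw.
elim/(@fsf_ind R V): v => [|a u w IHu IHw|y].
- by rewrite linear0 !(psd_sym ip_form _ 0) !psd0l.
- by rewrite linearP !psdDr !psdZr IHu IHw.
- by rewrite (psd_sym _ (nbmean _)) !ip_delta !nbmean_deltaE Esimple.1.
Qed.

(** Self-adjointness, tested against [delta x], turns the spreading of mass that defines [nbmean]
    into averaging over neighbors. *)
Lemma nbmeanE u x : nbmean u x = d%:R^-1 * \sum_(y <- nb x) u y.
Proof.
rewrite -ip_delta -nbmean_sym nbmean_delta psdZl; congr (_ * _).
elim/big_rec2: _ => [|y a b _ IH]; first by rewrite psd0l.
by rewrite psdDl ip_delta IH.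
Qed.

Lemma mass_nbmean u : mass (nbmean u) = mass u.
Proof.
elim/(@fsf_ind R V): u => [|a u w IHu IHw|x]; first by rewrite linear0.
  by rewrite !linearP /= IHu IHw.
rewrite nbmean_delta linearZ linear_sum /= mass_delta.
by under eq_bigr do rewrite mass_delta; rewrite sum_nb_const mulr1 /GRing.scale /= mulVf.
Qed.

Lemma nbmean_ge0 u : (forall x, 0 <= u x) -> forall x, 0 <= nbmean u x.
Proof.
by move=> u0 x; rewrite nbmeanE mulr_ge0 ?invr_ge0 ?ler0n// sumr_ge0.
Qed.

(** Apply [2 |a b| <= a^2 + b^2] along each edge. Both [fsf_sqr u] and its neighbor mean have mass
    [ip_form u u], so the two halves add up to the bound. *)
Lemma nbmean_contract u : `|ip_form u (nbmean u)| <= ip_form u u.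
Proof.
rewrite (@ip_formE _ _ _ _ (supp u))// (le_trans (ler_norm_sum _ _ _))//.
have h x : `|u x * nbmean u x| <= 2^-1 * (fsf_sqr u x + nbmean (fsf_sqr u) x).
  have -> : fsf_sqr u x = d%:R^-1 * \sum_(y <- nb x) (u x) ^+ 2.
    by rewrite sum_nb_const mulrA mulVf// mul1r.
  rewrite !nbmeanE -mulrDr -big_split /= mulrCA normrM.
  rewrite ger0_norm ?invr_ge0 ?ler0n// mulrCA ler_wpM2l ?invr_ge0 ?ler0n//.
  rewrite !mulr_sumr (le_trans (ler_norm_sum _ _ _))//; apply: ler_sum => y _.
  have := sqr_ge0 (u x - u y); have := sqr_ge0 (u x + u y).
  by rewrite sqrrD sqrrB ler_norml => ? ?; apply/andP; split; lra.
rewrite (le_trans (ler_sum _ (fun x _ => h x)))// -mulr_sumr big_split /=.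
have s0 x : 0 <= fsf_sqr u x by exact: sqr_ge0.
have := sum_le_mass (supp u) s0.
have := sum_le_mass (supp u) (nbmean_ge0 s0).
by rewrite mass_nbmean mass_sqr; lra.
Qed.

(** Laziness secures positivity: [nbmean] itself gives [-2 / d] on [delta x - delta y] for an edge,
    whereas the moment arguments need [lazy_ge0]. *)
Definition lazy u : fsf := 2^-1 *: (u + nbmean u).

Let lazy_is_linear : linear lazy.
Proof.
move=> a u v; rewrite /lazy linearP [a *: (_ *: _)]scalerA (mulrC a) -scalerA.
by rewrite -[RHS]scalerDr [a *: (u + _)]scalerDr addrACA.
Qed.
HB.instance Definition _ := GRing.isLinear.Build R fsf fsf _ lazy lazy_is_linear.

Lemma lazy_sym u v : ip_form (lazy u) v = ip_form u (lazy v).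
Proof. by rewrite psdZl psdZr psdDl psdDr nbmean_sym. Qed.

Lemma lazy_ge0 u : 0 <= ip_form u (lazy u).
Proof.
rewrite psdZr psdDr mulr_ge0//.
by have := nbmean_contract u; rewrite ler_norml => /andP[]; lra.
Qed.

Lemma lazy_le1 u : ip_form u (lazy u) <= ip_form u u.
Proof.
rewrite psdZr psdDr.
by have := nbmean_contract u; rewrite ler_norml => /andP[]; lra.
Qed.

Lemma lazy_coord_ge0 u : (forall x, 0 <= u x) -> forall x, 0 <= lazy u x.
Proof.
move=> u0 x; rewrite fsfZ fsfD mulr_ge0// addr_ge0//.
exact: nbmean_ge0.
Qed.

Lemma mass_lazy u : mass (lazy u) = mass u.
Proof. by rewrite linearZ linearD /= mass_nbmean /GRing.scale /=; lra. Qed.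

(** Hence [1 - nbmean] is twice [1 - lazy], and harmonicity may be tested with either operator. *)
Lemma nbmean_lazy u : nbmean u = 2 *: lazy u - u.
Proof. by rewrite /lazy scalerA divff// scale1r addrAC subrr add0r. Qed.

Lemma iter_lazy_delta_ge0 j x y : 0 <= iter j lazy (delta x) y.
Proof. by elim: j y => [|j IH] y /=; [rewrite ler0n|exact: lazy_coord_ge0]. Qed.

Lemma mass_iter_lazy j u : mass (iter j lazy u) = mass u.
Proof. by elim: j => //= j; rewrite mass_lazy. Qed.

Definition walk j : psd_form fsf := power_form lazy_sym lazy_ge0 j.

Lemma walkE j u v : walk j u v = ip_form u (iter j lazy v).
Proof. by []. Qed.

Section Aut.
Variable g : graph_aut E.

Lemma graph_aut_inj : injective g.
Proof. exact: bij_inj (graph_aut_bij g). Qed.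

Lemma nbmean_trans u : nbmean (trans g u) = trans g (nbmean u).
Proof.
elim/(@fsf_ind R V): u => [|a u v IHu IHv|x]; first by rewrite !linear0.
  by rewrite !linearP /= IHu IHv.
apply: fsfP => y; have [h _ hK] := graph_aut_bij g.
rewrite -(hK y) trans_delta nbmean_deltaE transE ?nbmean_deltaE ?graph_aut_adj//.
exact: graph_aut_inj.
Qed.

Lemma lazy_trans u : lazy (trans g u) = trans g (lazy u).
Proof. by rewrite /lazy [RHS]linearZ [in RHS]linearD /= nbmean_trans. Qed.

Lemma walk_trans j u v : walk j (trans g u) (trans g v) = walk j u v.
Proof.
rewrite !walkE -[RHS](ip_trans graph_aut_inj) (_ : iter j _ _ = trans g (iter j lazy v))//.
by elim: j => //= j ->; rewrite lazy_trans.
Qed.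

End Aut.

End Walk.

(** * Return probabilities *)

(** If the first ratio [r] exceeded [rho], log-convexity would keep all later ratios at least [r].
    Then [m j] would dominate [r ^+ j * m 0], which outgrows [C * rho ^+ j]. *)
Lemma logconvex_geometric_ratio (R : realType) (m : nat -> R) (C rho : R) :
  0 < rho -> (forall j, 0 <= m j) ->
  (forall j, m j.+1 ^+ 2 <= m j * m j.+2) ->
  (forall j, m j <= C * rho ^+ j) -> m 1%N <= rho * m 0%N.
Proof.
move=> rho0 m0 mlc mC; have [m00|m00] := eqVneq (m 0%N) 0.
  have := mlc 0%N; rewrite m00 mul0r => h.
  have /eqP : m 1%N ^+ 2 == 0 by rewrite eq_le h sqr_ge0.
  by move/eqP; rewrite sqrf_eq0 => /eqP->; rewrite mulr0.
have {}m00 : 0 < m 0%N by rewrite lt0r m00 m0.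
rewrite leNgt; apply/negP => lt.
pose r := m 1%N / m 0%N.
have rhor : rho < r by rewrite ltr_pdivlMr.
have r0 : 0 < r by exact: lt_trans rhor.
have mr j : 0 < m j /\ r * m j <= m j.+1.
  elim: j => [|j [mj IH]]; first by rewrite /r divfK ?gt_eqF.
  have mj1 : 0 < m j.+1 by rewrite (lt_le_trans _ IH)// mulr_gt0.
  split => //; rewrite -(ler_pM2l mj) (le_trans _ (mlc j))//.
  by rewrite mulrCA expr2 mulrA ler_wpM2r// ltW.
have mrj j : r ^+ j * m 0%N <= m j.
  elim: j => [|j IH]; first by rewrite mul1r.
  rewrite exprS -mulrA (le_trans _ (mr j).2)// ler_wpM2l//; exact: ltW.
have q1 : `|rho / r| < 1.
  by rewrite ger0_norm ?ltr_pdivrMr ?mul1r// divr_ge0// ltW.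
have bound j : m 0%N <= geometric C (rho / r) j.
  rewrite /= exprMn exprVn mulrA ler_pdivlMr ?exprn_gt0// mulrC.
  exact: le_trans (mrj j) (mC j).
have /(limr_ge (cvgP _ (cvg_geometric C q1))) :
    \forall j \near \oo, m 0%N <= geometric C (rho / r) j.
  by apply: nearW => j; exact: bound.
by rewrite (cvg_lim _ (cvg_geometric C q1))// leNgt m00.
Qed.

Section Transitive.
Context {R : realType} {V : choiceType}.
Variables (E : rel V) (d : nat).
Hypothesis Esimple : simple_graph E.
Hypothesis Ereg : regular_graph E d.
Hypothesis d_gt0 : (0 < d)%N.
Hypothesis Vinf : infinite_set [set: V].
Hypothesis Econn : connected_graph E.
Hypothesis Etrans : vertex_transitive E.
Variable o : V.

Local Notation fsf := (fsf R V).
Local Notation lazy := (@lazy R V E d).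
Local Notation nbmean := (@nbmean R V E d).
Local Notation walk := (@walk R V E d Esimple Ereg d_gt0).
Local Notation nb := (nb E).
Implicit Types u v : fsf.

Let dR_gt0 : 0 < d%:R :> R. Proof. by rewrite ltr0n. Qed.

Lemma walk_lazy j u : walk j u (lazy u) = walk j.+1 u u.
Proof. by rewrite !walkE -iterSr. Qed.

Lemma walk_lazy2 j u : walk j (lazy u) (lazy u) = walk j.+2 u u.
Proof. by rewrite !walkE -iterSr lazy_sym. Qed.

(** At a delta this second difference is [dret j - dret j.+1]: it gives the monotonicity of [dret]
    and, later, the squared defect of harmonicity. *)
Lemma walk_defect2 j u : walk j (u - lazy u) (u - lazy u) =
  walk j u u - walk j.+1 u u - (walk j.+1 u u - walk j.+2 u u).
Proof. by rewrite psd_sqrB walk_lazy walk_lazy2; ring. Qed.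

Let lsym := @lazy_sym R V E d Esimple Ereg.
Let lge0 := @lazy_ge0 R V E d Esimple Ereg d_gt0.
Let lle1 := @lazy_le1 R V E d Esimple Ereg d_gt0.

Let defect j : psd_form fsf :=
  power_form (defect_sym lsym lle1) (defect_ge0 lsym lge0 lle1) j.

Let defectE j u : defect j u u = walk j u u - walk j.+1 u u.
Proof. by []. Qed.

Definition ret j : R := walk j (delta o) (delta o).
Definition dret j := ret j - ret j.+1.

Lemma ret_delta j x : walk j (delta x) (delta x) = ret j.
Proof.
have [g go] := Etrans o x.
by rewrite -go -[delta (g o)]trans_delta walk_trans.
Qed.

Lemma ret_ge0 j : 0 <= ret j. Proof. exact: psd_ge0. Qed.

Lemma dret_ge0 j : 0 <= dret j.
Proof. by have := psd_ge0 (defect j) (delta o); rewrite defectE. Qed.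

Lemma dret_le j : dret j.+1 <= dret j.
Proof.
rewrite -subr_ge0; have := psd_ge0 (walk j) (delta o - lazy (delta o)).
by rewrite walk_defect2.
Qed.

Lemma dret_logconvex j : dret j.+1 ^+ 2 <= dret j * dret j.+2.
Proof. exact: (power_form_logconvex (defect_sym lsym lle1) (defect_ge0 lsym lge0 lle1)). Qed.

Lemma ret0 : ret 0 = 1.
Proof. by rewrite /ret walkE ip_delta /= eqxx. Qed.

Lemma ret1 : ret 1 = 2^-1.
Proof.
rewrite /ret walkE ip_delta fsfZ fsfD (nbmean_deltaE Ereg) Esimple.2 deltaE eqxx.
by rewrite mulr0 addr0 mulr1.
Qed.

(** By log-convexity every ratio [ret j.+1 / ret j] is at least the first one,
    [ret 1 / ret 0 = 1 / 2]. *)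
Lemma ret_gt0 j : 0 < ret j.
Proof.
suff [] : 0 < ret j /\ 2^-1 * ret j <= ret j.+1 by [].
elim: j => [|j [aj IH]]; first by rewrite ret0 ret1 mulr1.
have aj1 : 0 < ret j.+1 by rewrite (lt_le_trans _ IH)// mulr_gt0.
split=> //; rewrite -(ler_pM2l aj).
rewrite (le_trans _ (power_form_logconvex lsym lge0 j (delta o)))//.
by rewrite mulrCA mulrA expr2 ler_wpM2r// ltW.
Qed.

(** Expand the squares and use [nbmean = 2 lazy - 1]. After division by [dret j] the energy at a
    vertex is the constant [4 d], which justifies this normalization. *)
Lemma edge_energy j x :
  \sum_(y <- nb x) walk j (delta x - delta y) (delta x - delta y) = 4 * d%:R * dret j.
Proof.
under eq_bigr do rewrite psd_sqrB !ret_delta.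
have -> : \sum_(y <- nb x) (ret j - 2 * walk j (delta x) (delta y) + ret j) =
    d%:R * (2 * ret j) - 2 * walk j (delta x) (\sum_(y <- nb x) delta y).
  rewrite -(@sum_nb_const R V E d Ereg x).
  elim/big_rec3: _ => [|y a b c _ ->]; first by rewrite psd_sym psd0l; ring.
  by rewrite psdDr; ring.
have -> : \sum_(y <- nb x) delta y = d%:R *: nbmean (delta x).
  by rewrite nbmean_delta scalerA divff ?scale1r// gt_eqF.
rewrite psdZr nbmean_lazy psdBr psdZr walk_lazy !ret_delta /dret; ring.
Qed.

Lemma edge_bound j x y : E x y ->
  walk j (delta x - delta y) (delta x - delta y) <= 4 * d%:R * dret j.
Proof.
move=> xy; rewrite -(edge_energy j x) (big_fsetD1 y) ?(mem_nb Ereg)//= lerDl.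
by rewrite sumr_ge0// => z _; exact: (psd_ge0 (walk j)).
Qed.

(** Edge bounds are chained along a path from [x] to [y]; the constant depends on the path but not
    on [j]. *)
Lemma pair_bound x y : exists C : R, forall j,
  walk j (delta x - delta y) (delta x - delta y) <= C * dret j.
Proof.
have [p] := Econn x y; elim: p x => [x _ <-|z p IH x].
  by exists 0 => j; rewrite subrr psd0l mul0r.
rewrite [path _ _ _]/= [last _ _]/= => /andP[xz zp] py.
have [C zC] := IH z zp py; exists (2 * (4 * d%:R + C)) => j.
have -> : delta x - delta y = (delta x - delta z) + (delta z - delta y) :> fsf.
  by rewrite addrA subrK.
rewrite (le_trans (psd_sqrD_le _ _ _))// -mulrA ler_wpM2l// mulrDl lerD//.
exact: edge_bound.
Qed.

Let ret_decr : {homo ret : n m / (n <= m)%N >-> m <= n}.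
Proof.
apply: homo_leq => [x|x y z xy yz|n] //; first exact: le_trans yz xy.
by rewrite -subr_ge0; exact: dret_ge0.
Qed.

Let ret_cvg : cvgn ret.
Proof.
apply: nonincreasing_is_cvgn => //.
by exists 0 => _ [j _ <-]; exact: ret_ge0.
Qed.

Lemma dret_cvg0 : dret @ \oo --> (0 : R).
Proof.
rewrite -(subrr (limn ret)); apply: cvgB; first exact: ret_cvg.
by rewrite cvg_shiftS; exact: ret_cvg.
Qed.

(** Suppose the limit [a] were positive. Since [dret] tends to 0, [pair_bound] makes the probability
    of being at any fixed vertex at least about [a]; more than [1 / a] vertices would carry mass
    above 1. *)
Lemma ret_cvg0 : ret @ \oo --> (0 : R).
Proof.
suff <- : limn ret = 0 by exact: ret_cvg.
apply/le_anti/andP; split; last first.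
  by apply: limr_ge => //; apply: nearW => j; exact: ret_ge0.
rewrite leNgt; apply/negP => a0; set a := limn ret in a0.
have [A _ An] := infinite_set_fset (Num.bound a^-1) Vinf.
have [C CP] := choice (pair_bound o).
(* Expanding [walk j (delta o - delta y)] on the diagonal shows that the probability of reaching [y]
   falls short of [ret j] by at most [2^-1 * C y * dret j]. *)
pose K := \sum_(y <- A) 2^-1 * C y.
have h j : #|` A|%:R * a - K * dret j <= 1.
  have := sum_le_mass A (@iter_lazy_delta_ge0 R V E d Esimple Ereg j o).
  rewrite (mass_iter_lazy Ereg d_gt0) mass_delta; apply: le_trans.
  have -> : #|` A|%:R * a = \sum_(y <- A) a.
    by rewrite big_const_seq count_predT iter_addr_0 mulr_natl.
  rewrite /K mulr_suml -sumrB; apply: ler_sum => y _.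
  have -> : iter j lazy (delta o) y = walk j (delta y) (delta o).
    by rewrite walkE ip_delta.
  rewrite psd_sym; have := CP y j; rewrite psd_sqrB !ret_delta.
  have := nonincreasing_cvgn_ge ret_decr ret_cvg j.
  by rewrite -/a; lra.
have : #|` A|%:R * a <= 1.
  have cv : (fun j => #|` A|%:R * a - K * dret j) @ \oo --> #|` A|%:R * a - K * 0.
    by apply: cvgB; [exact: cvg_cst|apply: cvgMr; exact: dret_cvg0].
  rewrite mulr0 subr0 in cv; rewrite -(cvg_lim _ cv)//.
  by apply: limr_le; [exact: cvgP cv|exact: nearW].
apply/negP; rewrite -ltNge -ltr_pdivrMr// div1r.
rewrite (lt_le_trans (archi_boundP _)) ?ler_nat// invr_ge0; exact: ltW.
Qed.

(** A vanishing drop would make all later drops vanish, so [ret] would be constant from [j] on,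
    although it is positive and tends to 0. *)
Lemma dret_gt0 j : 0 < dret j.
Proof.
rewrite lt0r dret_ge0 andbT; apply/eqP => Dj.
have Dk k : dret (j + k) = 0.
  elim: k => [|k IH]; first by rewrite addn0.
  by apply/le_anti; rewrite dret_ge0 addnS -{1}IH dret_le.
have ak k : ret (j + k) = ret j.
  elim: k => [|k IH]; first by rewrite addn0.
  by have /eqP := Dk k; rewrite subr_eq0 addnS => /eqP <-.
have : ret j <= 0.
  have <- : limn ret = 0 by exact: cvg_lim ret_cvg0.
  apply: limr_ge; first exact: ret_cvg.
  near=> k; have jk : (j <= k)%N by near: k; exact: nbhs_infty_ge.
  by rewrite -(subnKC jk) ak.
by rewrite leNgt ret_gt0.
Unshelve. all: by end_near. Qed.

Lemma walk_le_ret u : exists C : R, forall j, walk j u u <= C * ret j.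
Proof.
elim/(@fsf_ind R V): u => [|a u v [C uC] [D vD]|x].
- by exists 0 => j; rewrite psd0l mul0r.
- exists (2 * (a ^+ 2 * C + D)) => j.
  rewrite (le_trans (psd_sqrD_le _ _ _))// -mulrA ler_wpM2l// mulrDl lerD//.
  by rewrite psd_sqrZ -[leRHS]mulrA ler_wpM2l// sqr_ge0.
- by exists 1 => j; rewrite mul1r ret_delta.
Qed.

(* If [dret] decayed geometrically, so would [ret], and the spectral radius of
   the lazy walk would be at most [rho]. *)
Lemma spectral_gap (rho : R) : 0 < rho < 1 ->
  (forall j, dret j.+1 <= rho * dret j) ->
  forall u, ip_form u (lazy u) <= rho * ip_form u u.
Proof.
move=> /andP[rho0 rho1] Drho u.
have rho1' : 0 < 1 - rho by rewrite subr_gt0.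
have Dj j : dret j <= dret 0 * rho ^+ j.
  elim: j => [|j IH]; first by rewrite mulr1.
  by rewrite (le_trans (Drho j))// exprS mulrCA ler_wpM2l// ltW.
(* Comparison with a geometric series, without summing it: [b] is nondecreasing with limit 0, hence
   nonpositive, which bounds [ret] by a multiple of [dret]. *)
pose b j := ret j - dret j / (1 - rho).
have b_incr : {homo b : n m / (n <= m)%N >-> n <= m}.
  apply: homo_leq => [x|x y z|n] //; first exact: le_trans.
  rewrite -subr_ge0.
  have -> : b n.+1 - b n = (rho * dret n - dret n.+1) / (1 - rho).
    have e : ret n = ret n.+1 + dret n by rewrite /dret; ring.
    by rewrite /b e; field; rewrite gt_eqF.
  by rewrite divr_ge0 ?(ltW rho1')// subr_ge0.
have b_cvg : b @ \oo --> (0 : R).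
  rewrite -[0](_ : 0 - 0 / (1 - rho) = 0); last by rewrite mul0r subr0.
  by apply: cvgB; [exact: ret_cvg0|apply: cvgMl; exact: dret_cvg0].
have aj j : ret j <= dret j / (1 - rho).
  rewrite -subr_le0 -/(b j).
  have <- : limn b = 0 by exact: cvg_lim b_cvg.
  by apply: nondecreasing_cvgn_le => //; exact: cvgP b_cvg.
have [C uC] := walk_le_ret u.
have C0 : 0 <= C by have := le_trans (psd_ge0 (walk 0) u) (uC 0%N); rewrite ret0 mulr1.
apply: (@logconvex_geometric_ratio _ (fun j => walk j u u) (C * (dret 0 / (1 - rho)))) => //.
- by move=> j; exact: psd_ge0.
- by move=> j; exact: (power_form_logconvex lsym lge0).
- move=> j; rewrite (le_trans (uC j))// -mulrA ler_wpM2l//.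
  rewrite (le_trans (aj j))// mulrAC ler_wpM2r// invr_ge0; exact: ltW.
Qed.

End Transitive.

(** * Amenability and the limit *)

Section Folner.
Context {R : realType} {V : choiceType}.
Variables (E : rel V) (d : nat).
Hypothesis Esimple : simple_graph E.
Hypothesis Ereg : regular_graph E d.
Hypothesis d_gt0 : (0 < d)%N.

Definition indicator (A : {fset V}) : fsf R V := \sum_(x <- A) delta x.

Lemma indicatorE (A : {fset V}) y : indicator A y = (y \in A)%:R.
Proof.
rewrite fsf_sum; have [yA|yA] := boolP (y \in A).
  rewrite (big_fsetD1 y)//= eqxx big_seq big1 ?addr0// => z.
  by rewrite !inE => /andP[/negPf->].
rewrite big_seq big1// => z zA; rewrite deltaE.
by case: eqVneq => // zy; rewrite -zy zA in yA.
Qed.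

Lemma ip_indicator (A : {fset V}) u : ip_form (indicator A) u = \sum_(x <- A) u x.
Proof.
rewrite (@ip_formE _ _ _ _ A).
  by rewrite big_seq [RHS]big_seq; apply: eq_bigr => x xA; rewrite indicatorE xA mul1r.
by move=> x; rewrite mem_supp indicatorE pnatr_eq0 eqb0 negbK.
Qed.

Lemma sum1_card (A : {fset V}) : \sum_(x <- A) (1 : R) = #|` A|%:R.
Proof. by rewrite big_const_seq count_predT iter_addr_0. Qed.

(** Every neighbor of [A] lies in [A] or [B], so the pairings of [indicator A] with the neighbor
    means of the two indicators sum to at least the size of [A]. By self-adjointness the pairing
    with [B] is at most the size of [B]. *)
Lemma nbmean_indicator_boundary (A B : {fset V}) :
  (forall x y, x \in A -> E x y -> (y \in A) || (y \in B)) ->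
  #|` A|%:R - #|` B|%:R <= ip_form (indicator A) (nbmean E d (indicator A)).
Proof.
move=> AB; rewrite lerBlDr.
have d0 : 0 < d%:R :> R by rewrite ltr0n.
have le1 y : nbmean E d (indicator A) y <= 1.
  rewrite (nbmeanE Esimple Ereg) ler_pdivrMl// mulr1 -[leRHS]mulr1 -(sum_nb_const Ereg y).
  by apply: ler_sum => z _; rewrite indicatorE lern1 leq_b1.
apply: (@le_trans _ _ (ip_form (indicator A) (nbmean E d (indicator A)) +
    ip_form (indicator A) (nbmean E d (indicator B)))).
  rewrite !ip_indicator -big_split -sum1_card big_seq [leRHS]big_seq.
  apply: ler_sum => x xA /=; rewrite !(nbmeanE Esimple Ereg) -mulrDr -big_split /=.
  rewrite ler_pdivlMl// -(sum_nb_const Ereg x) big_seq [leRHS]big_seq.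
  apply: ler_sum => y; rewrite (mem_nb Ereg) !indicatorE => /(AB _ _ xA).
  by case: (y \in A) => /= [_|->]; rewrite ?lerDl ?add0r.
rewrite lerD2l -(nbmean_sym Esimple Ereg) psd_sym ip_indicator -sum1_card.
exact: ler_sum.
Qed.

(** For a Folner set [A] with boundary [B], the preceding bound gives
    [<1_A, Q 1_A> >= |A| - |B| / 2]. A gap would keep [|B| / |A|] above [2 (1 - rho)]. *)
Lemma amenable_no_gap (rho : R) : amenable E R -> rho < 1 ->
  ~ (forall u : fsf R V, ip_form u (lazy E d u) <= rho * ip_form u u).
Proof.
move=> [S [Sfin Scvg]] rho1 gap.
have bound j : 2 * (1 - rho) <=
    #|` fset_set (S j `+` closed_neighborhood E (S j))|%:R / #|` fset_set (S j)|%:R.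
  have [Sj [z Sz]] := Sfin j.
  set A := fset_set (S j); set B := fset_set _.
  have A0 : 0 < #|` A|%:R :> R.
    rewrite ltr0n cardfs_gt0; apply/fset0Pn; exists z.
    by rewrite in_fset_set// mem_set.
  (* Finite degree makes the boundary finite, so that [fset_set] is not its default value here. *)
  have Bfin : finite_set (S j `+` closed_neighborhood E (S j)).
    have Nfin : finite_set (\bigcup_(x in S j) [set y | E x y]).
      by apply: bigcup_finite => // x _; exists d; exact: Ereg.
    apply: (@sub_finite_set _ _ (S j `|` \bigcup_(x in S j) [set y | E x y])).
      rewrite setYE => y [[Sy|[Sy|[x Sx xy]]] _]; [by left|by left|].
      by right; exists x.
    by rewrite finite_setU.
  have AB x y : x \in A -> E x y -> (y \in A) || (y \in B).
    rewrite !in_fset_set// => /set_mem xS xy.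
    have [//|yS /=] := boolP (y \in S j); apply/mem_set; right; split.
      by right; exists x.
    by move=> /mem_set; apply/negP.
  have := nbmean_indicator_boundary AB; have := gap (indicator A).
  rewrite psdZr psdDr.
  have -> : ip_form (indicator A) (indicator A) = #|` A|%:R.
    rewrite ip_indicator -sum1_card big_seq [RHS]big_seq.
    by apply: eq_bigr => x xA; rewrite indicatorE xA.
  by rewrite ler_pdivlMr//; lra.
have : 2 * (1 - rho) <= (0 : R).
  rewrite -(cvg_lim _ Scvg)//; apply: limr_ge; first exact: cvgP Scvg.
  exact: nearW.
by lra.
Qed.

End Folner.

Definition psd_scale (R : realType) (M : lmodType R) (c : R) (c0 : 0 <= c)
  (B : psd_form M) : psd_form M.
Proof.
exists (fun u v => c * B u v) => [w a u v|u v|u].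
- by rewrite psd_linear; ring.
- by rewrite psd_sym.
- by rewrite mulr_ge0// psd_ge0.
Defined.

(** In degree 0 no path leaves its starting vertex, so a connected graph would be a single point. *)
Lemma infinite_connected_degree_gt0 (V : choiceType) (E : rel V) (d : nat) :
  infinite_set [set: V] -> connected_graph E -> regular_graph E d -> (0 < d)%N.
Proof.
move=> Vinf Econn Ereg; rewrite lt0n; apply/eqP => d0.
have [/= o _] := infinite_setN0 Vinf.
apply: Vinf; apply: (@sub_finite_set _ _ [set o]) => // y _ /=.
have [p] := Econn o y; case: p => [_ <-//|z p /= /andP[oz _] _].
have := Ereg o; rewrite d0 II0 card_eq0 => /eqP /seteqP[sub _].
by case: (sub z oz).
Qed.

(** * The limiting form and the harmonic embedding *)

Section Limit.
Context {R : realType} {V : choiceType}.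
Variables (E : rel V) (d : nat).
Hypothesis Esimple : simple_graph E.
Hypothesis Ereg : regular_graph E d.
Hypothesis d_gt0 : (0 < d)%N.
Hypothesis Vinf : infinite_set [set: V].
Hypothesis Econn : connected_graph E.
Hypothesis Etrans : vertex_transitive E.
Hypothesis Eam : amenable E R.
Variable o : V.

Local Notation walk := (@walk R V E d Esimple Ereg d_gt0).
Local Notation dret := (@dret R V E d Esimple Ereg d_gt0 o).

Let dret_pos j : 0 < dret j := dret_gt0 Esimple Ereg d_gt0 Vinf Econn Etrans o j.

Lemma dret_ratio_cvg1 : (fun j => dret j.+1 / dret j) @ \oo --> (1 : R).
Proof.
apply: ratio_cvg1.
- exact: dret_pos.
- exact: dret_le.
- exact: dret_logconvex.
- move=> rho rho01; apply: contrapT => /forallNP gap.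
  have /andP[_ rho1] := rho01.
  apply: (amenable_no_gap Esimple Ereg d_gt0 Eam rho1).
  apply: (spectral_gap Vinf Econn Etrans rho01) => j.
  by rewrite leNgt; apply/negP; exact: gap.
Qed.

Let inv_dret_ge0 j : 0 <= (dret j)^-1. Proof. by rewrite invr_ge0 ltW. Qed.

Definition normalized_walk j : psd_form (fsf R V) := psd_scale (inv_dret_ge0 j) (walk j).

Lemma normalized_walkE j u v : normalized_walk j u v = (dret j)^-1 * walk j u v.
Proof. by []. Qed.

Local Notation Bn := normalized_walk.
Local Notation M := (bdd Bn).

Let pair_subproof x y : (delta x - delta y : fsf R V) \in bounded_along Bn.
Proof.
have [C CP] := @pair_bound R _ _ _ Esimple Ereg d_gt0 Econn Etrans o x y.
apply/asboolP; exists C => j; rewrite normalized_walkE.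
by rewrite mulrC ler_pdivrMr ?CP.
Qed.

Definition pair x y : M := Bdd (pair_subproof x y).

Let act_subproof (g : graph_aut E) (u : M) : trans g (bdd_val u) \in bounded_along Bn.
Proof.
case: u => u /= /asboolP[C uC]; apply/asboolP; exists C => j.
by rewrite normalized_walkE walk_trans; exact: uC.
Qed.

Definition bdd_act (g : graph_aut E) (u : M) : M := Bdd (act_subproof g u).

Lemma bddP (u v : M) : bdd_val u = bdd_val v -> u = v. Proof. exact: val_inj. Qed.

Lemma bdd_actP g a u v : bdd_act g (a *: u + v) = a *: bdd_act g u + bdd_act g v.
Proof. by apply: bddP; exact: linearP. Qed.

Lemma trans_id (u : fsf R V) : trans id u = u.
Proof. by rewrite [RHS]fsf_expand. Qed.

Lemma trans_comp (g h : V -> V) (u : fsf R V) : trans (g \o h) u = trans g (trans h u).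
Proof.
elim/(@fsf_ind R V): u => [|a u v IHu IHv|x]; first by rewrite !linear0.
  by rewrite !linearP /= IHu IHv.
by rewrite !trans_delta.
Qed.

Lemma bdd_act1 u : bdd_act 1%g u = u.
Proof. by apply: bddP; exact: trans_id. Qed.

Lemma bdd_actM g h u : bdd_act (g * h)%g u = bdd_act g (bdd_act h u).
Proof. by apply: bddP; exact: trans_comp. Qed.

Lemma bdd_act_pair g x y : bdd_act g (pair x y) = pair (g x) (g y).
Proof. by apply: bddP; rewrite /= linearB /= !trans_delta. Qed.

Lemma pairD x y z : pair x y + pair y z = pair x z.
Proof. by apply: bddP; rewrite /= addrA subrK. Qed.

Variable U : set_system nat.
Hypothesis U_ultra : UltraFilter U.
Hypothesis U_oo : \oo `<=` U.

Definition limit_form : psd_form M := ulim_form U_ultra Bn.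

Lemma bdd_act_isom g u v : limit_form (bdd_act g u) (bdd_act g v) = limit_form u v.
Proof.
rewrite /= /ulim; congr (lim (_ @ U)); apply/funext => j /=.
by congr (_ * _); exact: (walk_trans Esimple Ereg d_gt0 g).
Qed.

Definition harmonic_emb (x : V) : gns_hilbert limit_form := gns_vec limit_form (pair x o).

Lemma harmonic_emb_harmonic : harmonic_map E d harmonic_emb.
Proof.
move=> x; rewrite fsbig_finite; last by exists d; exact: Ereg.
rewrite -/(nb E x).
pose w : M := pair x o - d%:R^-1 *: \sum_(y <- nb E x) pair y o.
have wE : harmonic_emb x - d%:R^-1 *: \sum_(y <- nb E x) harmonic_emb y = gns_vec limit_form w.
  by rewrite /w [RHS]linearB; congr (_ - _); rewrite [RHS]linearZ [in RHS]linear_sum.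
have d0 : d%:R != 0 :> R by rewrite pnatr_eq0 -lt0n.
(* The base point [o] cancels because exactly [d] neighbors are averaged; the factor 2 comes from
   [nbmean_lazy]. *)
have wval : bdd_val w = 2 *: (delta x - lazy E d (delta x)).
  have sumE : bdd_val (\sum_(y <- nb E x) pair y o) =
      \sum_(y <- nb E x) (delta y - delta o) :> fsf R V.
    by elim/big_rec2: _ => // y u v _ <-.
  have -> : bdd_val w = (delta x - delta o) -
      d%:R^-1 *: bdd_val (\sum_(y <- nb E x) pair y o) by [].
  rewrite sumE sumrB scalerBr -nbmean_delta (nbmean_lazy E d).
  have -> : \sum_(y <- nb E x) delta o = d%:R *: delta o :> fsf R V.
    by rewrite big_const_seq count_predT (card_nb Ereg) iter_addr_0 scaler_nat.
  rewrite [d%:R^-1 *: (_ *: delta o)]scalerA mulVf// scale1r.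
  by move: (lazy E d (delta x)) => L; apply: fsfP => z; rewrite !(fsfB, fsfZ); ring.
apply/eqP; rewrite -subr_eq0 wE -normr_eq0 -sqrf_eq0 gns_vec_norm.
apply/eqP/ulim_formE => //.
under eq_fun do rewrite wval psd_sqrZ.
have -> : (fun j => 2 ^+ 2 *
      Bn j (delta x - lazy E d (delta x)) (delta x - lazy E d (delta x))) =
    (fun j => 2 ^+ 2 * (1 - dret j.+1 / dret j)).
  (* By [walk_defect2] the normalized square is [(dret j - dret j.+1) / dret j]. *)
  apply/funext => j; congr (_ * _).
  rewrite normalized_walkE walk_defect2 !(ret_delta _ _ _ Etrans o) -/(dret j) -/(dret j.+1).
  by field; rewrite gt_eqF.
rewrite -(mulr0 (2 ^+ 2)) -(subrr 1); apply: cvgMr; apply: cvgB; first exact: cvg_cst.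
exact: dret_ratio_cvg1.
Qed.

(** For a constant map every [pair o y] has limiting norm 0, so the normalized energy at [o], a
    finite sum, would tend to 0 along [U]. By [edge_energy] it is always [4 d]. *)
Lemma harmonic_emb_nonconstant : exists x y, harmonic_emb x <> harmonic_emb y.
Proof.
apply: contrapT => /forallNP cst.
have zero y : limit_form (pair o y) (pair o y) = 0.
  rewrite -gns_vec_norm.
  have -> : pair o y = pair o o - pair y o by apply: bddP; rewrite /= subrr sub0r opprB.
  rewrite linearB /=.
  have -> : gns_vec limit_form (pair o o) = gns_vec limit_form (pair y o).
    by apply: contrapT => h; apply: (cst o); exists y.
  by rewrite subrr normr0 expr0n.
have cv (s : seq V) : (fun j => \sum_(y <- s) Bn j (pair o y) (pair o y)) @ U --> (0 : R).
  elim: s => [|y s IH].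
    by under eq_fun do rewrite big_nil; exact: cvg_cst.
  have h : (fun j => Bn j (pair o y) (pair o y) +
      \sum_(z <- s) Bn j (pair o z) (pair o z)) @ U --> (0 + 0 : R).
    by apply: cvgD; [rewrite -(zero y); exact: ulim_cvg|exact: IH].
  by under eq_fun do rewrite big_cons; rewrite addr0 in h.
have := cv (nb E o).
have -> : (fun j => \sum_(y <- nb E o) Bn j (pair o y) (pair o y)) = (fun=> 4 * d%:R).
  apply/funext => j; rewrite -mulr_sumr (edge_energy _ _ _ Etrans o).
  by rewrite mulrC mulfK// gt_eqF.
move=> /(cvg_lim (@Rhausdorff R)); rewrite lim_cst// => /eqP.
by rewrite mulf_eq0 !pnatr_eq0 /= -leqn0 leqNgt d_gt0.
Qed.

(** The cocycle is the displacement of the base point, [g o - o]: formally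
    [g (x - o) + (g o - o) = g x - o]. *)
Lemma harmonic_emb_equivariant :
  exists pi : graph_aut E -> gns_hilbert limit_form -> gns_hilbert limit_form,
  affine_isometric_action pi /\
  forall g x, pi g (harmonic_emb x) = harmonic_emb (g x).
Proof.
exists (gns_affine (fun g : graph_aut E => pair (g o) o) bdd_actP bdd_act_isom); split.
  apply: gns_affine_isometric_action; [exact: bdd_act1|exact: bdd_actM|].
  by move=> g h; rewrite bdd_act_pair pairD.
move=> g x; rewrite gns_affine_vec; [|exact: bdd_act1|exact: bdd_actM].
by rewrite bdd_act_pair pairD.
Qed.

End Limit.

Theorem theorem1p3 (R : realType) (V : choiceType) (E : rel V) (d : nat)
  (Esimple : simple_graph E) (Vinf : infinite_set [set: V]%classic)
  (Econn : connected_graph E) (Eam : amenable E R)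
  (Etrans : vertex_transitive E) (Ereg : regular_graph E d) :
  exists (H : hilbertSpace R) (Psi : V -> H),
    [/\ exists x y, Psi x <> Psi y,
        harmonic_map E d Psi
      & exists pi : graph_aut E -> H -> H,
          affine_isometric_action pi /\
          forall (g : graph_aut E) (x : V), pi g (Psi x) = Psi (g x)].
Proof.
have d_gt0 := infinite_connected_degree_gt0 Vinf Econn Ereg.
have [/= o _] := infinite_setN0 Vinf.
(* An ultrafilter finer than the eventual filter assigns limits to all bounded real sequences and
   agrees with ordinary limits where these exist. *)
have [U [U_ultra U_oo]] := ultraFilterLemma eventually_filter.
exists (gns_hilbert (limit_form Esimple Ereg d_gt0 Vinf Econn Etrans o U_ultra)).
exists (harmonic_emb Esimple Ereg d_gt0 Vinf Econn Etrans o U_ultra); split.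
- exact: harmonic_emb_nonconstant.
- exact: harmonic_emb_harmonic.
- exact: harmonic_emb_equivariant.
Qed.
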